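(* Let $S$ be a proper sampling on $[n]$ with weights $\theta_S^i=1/p_i$, where $p_i=\mathbb{P}[i\in S]$, and let each $f_i:\mathbb{R}^d\to\mathbb{R}$ be $L_i$-smooth. Let $\mathcal{L}_3$ be the constant defined in the context. (i) If $S$ is the $\tau$-nice sampling (with $n\ge2$), then $$\mathcal{L}_3\le\frac{n-\tau}{\tau(n-1)}\cdot\frac1n\sum_{i=1}^nL_i^2.$$ (ii) If $S$ is a group sampling with set of isolated indices $\mathcal{I}$, then $$\mathcal{L}_3\le\frac{1}{n^2}\left(\sum_{i\in\mathcal{I}}\left(\frac{1}{p_i}-1\right)L_i^2+\sum_{i\notin\mathcal{I}}\frac{1}{p_i}L_i^2\right).$$
   Context: $[n]=\{1,\dots,n\}$; $e\in\mathbb{R}^n$ is the all-ones vector. A sampling is a random subset $S$ of $[n]$; it is proper if $p_i=\mathbb{P}[i\in S]>0$ for all $i$. $L$-smooth means differentiable with $L$-Lipschitz gradient; the $f_i$ need not be convex. $\tau$-nice sampling: $S$ is uniformly distributed over all subsets of $[n]$ of cardinality $\tau$ ($1\le\tau\le n$). Group sampling: numbers $p_i\in(0,1]$ are given; $[n]$ is partitioned into groups $C_1,\dots,C_t$ with $\sum_{i\in C_j}p_i\le1$ for every $j$; independently over groups, with probability $\sum_{i\in C_j}p_i$ exactly one index is chosen from $C_j$ (otherwise none), the chosen index being $i\in C_j$ with probability $p_i/\sum_{s\in C_j}p_s$. $S$ is the set of chosen indices, so $\mathbb{P}[i\in S]=p_i$. An index $i$ is isolated if $\{i\}$ is itself one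 of the groups. $\theta_S$ is the diagonal matrix with entries $\theta_S^i$, $\mathbf{I}_S$ is the diagonal $0/1$ indicator matrix of $S$, and $\mathbf{G}(x)=[\nabla f_1(x),\dots,\nabla f_n(x)]$, so $\frac1n\mathbf{G}(x)\theta_S\mathbf{I}_Se=\frac1n\sum_{i\in S}\theta_S^i\nabla f_i(x)$. $\mathcal{L}_3$ is the smallest constant $\ge0$ such that for all $x,y\in\mathbb{R}^d$: $\mathbb{E}\left[\|\frac1n(\mathbf{G}(x)-\mathbf{G}(y))\theta_S\mathbf{I}_Se-\frac1n(\mathbf{G}(x)-\mathbf{G}(y))e\|^2\right]\le\mathcal{L}_3\|x-y\|^2$. *)

(* Defs.v *)
From HB Require Import structures.
From mathcomp Require Import all_boot all_order all_algebra.
From mathcomp Require Import all_classical all_reals all_analysis.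

Set Implicit Arguments.
Unset Strict Implicit.
Unset Printing Implicit Defensive.

Import Order.TTheory GRing.Theory Num.Theory.
Import numFieldNormedType.Exports.

Local Open Scope classical_set_scope.
Local Open Scope ring_scope.

(* The library norm on ['cV[R]_d] is the sup norm, hence this definition. *)
Definition norm2 (R : realType) (d : nat) (v : 'cV[R]_d) : R :=
  Num.sqrt (\sum_(k < d) v k 0 ^+ 2).

(* The partial derivatives are directional derivatives along the canonical
   basis; [smooth] below also requires (Frechet) differentiability. *)
Definition gradient (R : realType) (d : nat) (f : 'cV[R]_d -> R)
    (x : 'cV[R]_d) : 'cV[R]_d :=
  \col_k 'D_(delta_mx k 0) f x.

Definition smooth (R : realType) (d : nat) (L : R) (f : 'cV[R]_d -> R) : Prop :=
  (forall x, differentiable f x) /\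
  (forall x y, norm2 (gradient f x - gradient f y) <= L * norm2 (x - y)).

Definition gradients (R : realType) (d n : nat) (f : 'I_n -> 'cV[R]_d -> R)
    (x : 'cV[R]_d) : 'M[R]_(d, n) :=
  \matrix_(k, i) gradient (f i) x k 0.

Section Sampling.
Context (R : realType) (dT : measure_display) (T : measurableType dT).
Context (P : probability T R) (n : nat).

(* Measurability of [S] for the discrete sigma-algebra on [{set 'I_n}]. *)
Definition sampling (S : T -> {set 'I_n}) : Prop :=
  forall A : {set 'I_n}, measurable [set w | S w = A].

Definition incl_prob (S : T -> {set 'I_n}) (i : 'I_n) : R :=
  fine (P [set w | i \in S w]).

Definition proper_sampling (S : T -> {set 'I_n}) : Prop :=
  forall i, 0 < incl_prob S i.

Definition nice_sampling (tau : nat) (S : T -> {set 'I_n}) : Prop :=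
  (1 <= tau <= n)%N /\
  forall A : {set 'I_n},
    P [set w | S w = A] =
    (if #|A| == tau then ('C(n, tau)%:R)^-1 else 0)%:E.

(* Mutual independence of the finitely-valued random variables [X j], for
   [j] in [D]. *)
Definition mutually_independent (J V : finType) (D : {set J})
    (X : J -> T -> V) : Prop :=
  forall (D' : {set J}) (E : J -> {set V}), D' \subset D ->
    P [set w | forall j, j \in D' -> X j w \in E j] =
    (\prod_(j in D') fine (P [set w | X j w \in E j]))%:E.

(* [C] is the set of groups. The random choice made in the group [B] is
   [S w :&: B]: either empty or a singleton. *)
Record group_sampling (q : 'I_n -> R) (C : {set {set 'I_n}})
    (S : T -> {set 'I_n}) : Prop := GroupSampling {
  group_weight : forall i, 0 < q i <= 1;
  group_partition : finset.partition C [set: 'I_n]%SET;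
  group_sum_le1 : forall B, B \in C -> \sum_(i in B) q i <= 1;
  group_pick : forall B i, B \in C -> i \in B ->
    P [set w | (S w :&: B)%SET = [set i]%SET] =
    ((\sum_(s in B) q s) * (q i / \sum_(s in B) q s))%:E;
  group_none : forall B, B \in C ->
    P [set w | (S w :&: B)%SET = finset.set0] = (1 - \sum_(s in B) q s)%:E;
  group_independent :
    mutually_independent C (fun B w => (S w :&: B)%SET)
}.

Definition isolated_index (C : {set {set 'I_n}}) (i : 'I_n) : bool :=
  ([set i] \in C)%SET.

(* [theta A i] is the weight of [i] when the sampled set is [A]. *)
Definition weight_mx (theta : {set 'I_n} -> 'I_n -> R) (A : {set 'I_n}) :
  'M[R]_n := diag_mx (\row_i theta A i).

Definition indic_mx (A : {set 'I_n}) : 'M[R]_n :=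
  diag_mx (\row_i (i \in A)%:R).

Definition ones : 'cV[R]_n := const_mx 1.

Definition L3_bound (d : nat) (f : 'I_n -> 'cV[R]_d -> R)
    (S : T -> {set 'I_n}) (theta : {set 'I_n} -> 'I_n -> R) : set R :=
  [set c | 0 <= c /\ forall x y : 'cV[R]_d,
    ('E_P[fun w => (
       norm2 (n%:R^-1 *: ((gradients f x - gradients f y)
                            *m weight_mx theta (S w) *m indic_mx (S w) *m ones)
              - n%:R^-1 *: ((gradients f x - gradients f y) *m ones)) ^+ 2)%R]
     <= (c * norm2 (x - y) ^+ 2)%:E)%E].

Definition is_L3 (d : nat) (f : 'I_n -> 'cV[R]_d -> R)
    (S : T -> {set 'I_n}) (theta : {set 'I_n} -> 'I_n -> R) (c : R) : Prop :=
  L3_bound f S theta c /\ lbound (L3_bound f S theta) c.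

End Sampling.

Arguments ones {R n}.
Arguments indic_mx {R n}.

(* Main.v *)
Require Import Defs.
From mathcomp Require Import all_boot all_order all_algebra.
From mathcomp Require Import all_classical all_reals all_analysis.
From mathcomp Require Import measurable_realfun ring lra zify.

(** Write [M := G(x) - G(y)], with columns [h_i].  The random vector whose
    second moment defines the constant is
    [n^-1 sum_i (1_(i in S) / p_i - 1) h_i], so by expanding the square
    ([second_moment], applied in each coordinate of R^d) the expectation equals
    [n^-2 sum_(i, j) (p_ij / (p_i p_j) - 1) <h_i, h_j>],
    where [p_ij = P(i in S, j in S)].  If this quadratic form is dominated by a
    diagonal one, [sum_i a_i |h_i|^2] with [a_i >= 0], then smoothness
    ([|h_i| <= L_i |x - y|]) shows that [n^-2 sum_i a_i L_i^2] is an admissible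
    constant ([diag_bound_L3_bound]).  What depends on the sampling is the
    choice of the [a_i].

    For the tau-nice sampling, a count of the sets of size [tau] containing one
    or two given indices gives [p_i = tau / n] and
    [p_ij = tau (tau - 1) / (n (n - 1))].  With
    [b = (n - tau) / (tau (n - 1))] the form becomes
    [b (n sum_i |h_i|^2 - |sum_i h_i|^2)], and the negative term is dropped
    ([nice_excess_quad_le]).

    For a group sampling, [p_ij = p_i p_j] across groups by independence, and
    [p_ij = 0] for distinct indices of one group, because the probabilities of
    drawing nothing and of drawing exactly one index already add up to 1
    ([group_same_block]).  The form becomes
    [sum_i |h_i|^2 / p_i - sum_B |sum_(i in B) h_i|^2]; keeping only the
    singleton groups in the subtracted sum gives the coefficients
    [1 / p_i - 1] for isolated indices and [1 / p_i] for the others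
    ([group_excess_quad_le]).

    The smallest constant exists since every quadratic form is dominated by a
    diagonal one, so that admissible constants exist, and they form a closed
    set bounded below by 0 ([is_L3_exists]). *)

Import Order.TTheory GRing.Theory Num.Theory.
Import numFieldNormedType.Exports.

Local Open Scope ring_scope.

Set Implicit Arguments.
Unset Strict Implicit.
Unset Printing Implicit Defensive.

(** * Laws on the subsets of a finite set *)

Section FiniteLaw.
Context (R : realFieldType) (I : finType) (mu : {set I} -> R).
Implicit Types (A B K : {set I}) (i j : I) (m : I -> R).

(** Mass of the sets that contain [K].  [mu] is any weight function on the
    subsets of [I]; that its total mass is 1 is assumed only where it is used. *)
Definition incl_law K : R := \sum_(A : {set I} | K \subset A) mu A.

(** The inclusion probability [p_i]. *)
Definition marginal i : R := incl_law [set i].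

(** The joint inclusion probability [p_ij]; it equals [p_i] when [i = j]. *)
Definition pair_marginal i j : R := incl_law [set i; j].

(** The quadratic form [sum_(i, j) (p_ij / (p_i p_j) - 1) m_i m_j]. *)
Definition excess_quad m : R :=
  \sum_i \sum_j (pair_marginal i j / (marginal i * marginal j) - 1) * (m i * m j).

Lemma incl_lawE K : incl_law K = \sum_A mu A * (K \subset A)%:R.
Proof.
rewrite /incl_law big_mkcond; apply: eq_bigr => A _.
by case: (K \subset A); rewrite ?mulr1 ?mulr0.
Qed.

Lemma marginalE i : marginal i = \sum_A mu A * (i \in A)%:R.
Proof. by rewrite /marginal incl_lawE; under eq_bigr do rewrite finset.sub1set. Qed.

Lemma pair_marginalE i j :
  pair_marginal i j = \sum_A mu A * ((i \in A)%:R * (j \in A)%:R).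
Proof.
rewrite /pair_marginal incl_lawE; apply: eq_bigr => A _.
by rewrite finset.subUset !finset.sub1set -natrM mulnb.
Qed.

Lemma pair_marginalii i : pair_marginal i i = marginal i.
Proof. by rewrite /pair_marginal finset.setUid. Qed.

(** The quadratic form is the variance of the unbiased estimator
    [sum_(i in A) m_i / p_i] of [sum_i m_i]. *)
Lemma second_moment m : \sum_A mu A = 1 -> (forall i, marginal i != 0) ->
  \sum_A mu A * (\sum_i (((i \in A)%:R / marginal i) - 1) * m i) ^+ 2 =
  excess_quad m.
Proof.
move=> pi1 p0; rewrite /excess_quad.
transitivity (\sum_A \sum_i \sum_j
   mu A * (((i \in A)%:R / marginal i - 1) * ((j \in A)%:R / marginal j - 1))
     * (m i * m j)).
  apply: eq_bigr => A _; rewrite expr2 big_distrlr mulr_sumr.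
  apply: eq_bigr => i _; rewrite mulr_sumr; apply: eq_bigr => j _ /=; ring.
rewrite exchange_big; apply: eq_bigr => i _.
rewrite exchange_big; apply: eq_bigr => j _.
rewrite -mulr_suml; congr (_ * _).
transitivity (\sum_A (mu A * ((i \in A)%:R * (j \in A)%:R) / (marginal i * marginal j)
   - mu A * (i \in A)%:R / marginal i - mu A * (j \in A)%:R / marginal j + mu A)).
  by apply: eq_bigr => A _; field; rewrite !p0.
rewrite big_split !sumrB /= -!mulr_suml -pair_marginalE -!marginalE pi1.
by rewrite !divff //; ring.
Qed.

(** By [|m_i m_j| <= (m_i^2 + m_j^2) / 2], whatever the law. *)
Lemma excess_quad_diag_bound : exists a : I -> R, (forall i, 0 <= a i) /\
  forall m, excess_quad m <= \sum_i a i * m i ^+ 2.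
Proof.
pose c i j := `|pair_marginal i j / (marginal i * marginal j) - 1|.
exists (fun i => (\sum_j c i j + \sum_j c j i) / 2); split.
  by move=> i; rewrite divr_ge0 // addr_ge0 // sumr_ge0 // => j _; rewrite normr_ge0.
move=> m.
apply: (@le_trans _ _ (\sum_i \sum_j (c i j / 2 * m i ^+ 2 + c i j / 2 * m j ^+ 2))).
  apply: ler_sum => i _; apply: ler_sum => j _.
  apply: le_trans (ler_norm _) _; rewrite normrM -/(c i j) -mulrDr.
  rewrite -mulrA ler_wpM2l ?normr_ge0 //.
  rewrite ler_norml; apply/andP; split.
    by have := sqr_ge0 (m i + m j); lra.
  by have := sqr_ge0 (m i - m j); lra.
under eq_bigr do rewrite big_split.
rewrite big_split /= [X in _ + X]exchange_big -big_split /=.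
rewrite le_eqVlt; apply: predU1l; apply: eq_bigr => i _.
by rewrite -!mulr_suml; ring.
Qed.

End FiniteLaw.

(** * Uniform law on the subsets of a given cardinality *)

Section Nice.
Context (R : realFieldType) (I : finType).
Implicit Types (K : {set I}).

(** Complementation maps the sets of size [t] containing [K] onto the subsets
    of size [#|I| - t] of the complement of [K]. No lower bound on [t] is
    needed: if [t < #|K|] both sides vanish. *)
Lemma card_supersets K (t : nat) : (t <= #|I|)%N ->
  #|[set A : {set I} | K \subset A & #|A| == t]| = 'C(#|I| - #|K|, #|I| - t).
Proof.
move=> tI; have -> : (#|I| - #|K| = #|finset.setC K|)%N by have := finset.cardsC K; lia.
rewrite -cards_draws.
rewrite -(card_imset _ (can_inj (@finset.setCK I))); apply: eq_card => A.
rewrite -[A in LHS](finset.setCK A) (mem_imset _ _ (can_inj (@finset.setCK I))).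
rewrite !inE -[A \subset _]finset.setCS finset.setCK; congr (_ && _).
by have := cardsC A => AI; apply/eqP/eqP; lia.
Qed.

Context (t : nat) (mu : {set I} -> R).
Context (t_bounds : (1 <= t <= #|I|)%N).
Context (muE : forall A, mu A = if #|A| == t then ('C(#|I|, t)%:R)^-1 else 0).

Lemma nice_incl_law K :
  incl_law mu K = 'C(#|I| - #|K|, #|I| - t)%:R / 'C(#|I|, #|I| - t)%:R.
Proof.
have /andP[_ tI] := t_bounds.
rewrite /incl_law (eq_bigr _ (fun A _ => muE A)) -big_mkcondr /= bin_sub //.
rewrite -card_supersets // -sum1dep_card natr_sum mulr_suml.
by apply: eq_big => [A|A _]; rewrite ?mul1r.
Qed.

Lemma nice_marginal i : marginal mu i = t%:R / #|I|%:R.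
Proof.
have /andP[t0 tI] := t_bounds.
have b0 : 'C(#|I|, #|I| - t)%:R != 0 :> R.
  by rewrite pnatr_eq0 -lt0n bin_gt0 leq_subr.
have n0 : #|I|%:R != 0 :> R by rewrite pnatr_eq0; lia.
rewrite /marginal nice_incl_law cards1 subn1; apply/eqP; rewrite eqr_div //.
by rewrite -!natrM mulnC mul_bin_down subKn.
Qed.

Lemma nice_pair_marginal i j : i != j ->
  pair_marginal mu i j =
  t%:R * (t%:R - 1) / (#|I|%:R * (#|I|%:R - 1)).
Proof.
move=> ij; have /andP[t0 tI] := t_bounds.
have n2 : (2 <= #|I|)%N.
  by have := max_card (mem [set i; j]%SET); rewrite cards2 ij.
have n0 : #|I|%:R != 0 :> R by rewrite pnatr_eq0; lia.
have n1 : #|I|%:R - 1 != 0 :> R.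
  by rewrite subr_eq0 pnatr_eq1; lia.
have step : (#|I|%:R - 1) * 'C(#|I| - 2, #|I| - t)%:R =
            (t%:R - 1) * 'C(#|I| - 1, #|I| - t)%:R :> R.
  rewrite -(natrB R t0) -(natrB R (ltnW n2)) -!natrM; congr _%:R.
  have := mul_bin_down (#|I| - 1) (#|I| - t).
  have -> : (#|I| - 1).-1 = (#|I| - 2)%N by lia.
  by have -> : (#|I| - 1 - (#|I| - t) = t - 1)%N by lia.
have -> : t%:R * (t%:R - 1) / (#|I|%:R * (#|I|%:R - 1)) =
    (t%:R - 1) / (#|I|%:R - 1) * (t%:R / #|I|%:R) :> R by field; rewrite n0 n1.
rewrite -(nice_marginal i) /marginal /pair_marginal !nice_incl_law cards1 cards2 ij.
rewrite mulrA; congr (_ * _); apply: (mulfI n1).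
rewrite -[(true.+1)]/2%N step; field.
by [].

Qed.

(** The form equals [b * (#|I| * sum_i m_i^2 - (sum_i m_i)^2)], where
    [b = (#|I| - t) / (t * (#|I| - 1))]. *)
Lemma nice_excess_quad_le (m : I -> R) : (2 <= #|I|)%N ->
  excess_quad mu m <=
  \sum_i (#|I|%:R * ((#|I|%:R - t%:R) / (t%:R * (#|I|%:R - 1)))) * m i ^+ 2.
Proof.
move=> n2; have /andP[t0 tI] := t_bounds.
have n0 : #|I|%:R != 0 :> R by rewrite pnatr_eq0; lia.
have n1 : 0 < #|I|%:R - 1 :> R by rewrite subr_gt0 ltr1n.
have n1' := lt0r_neq0 n1.
have t0' : t%:R != 0 :> R by rewrite pnatr_eq0; lia.
set b := (_ / (t%:R * _)).
have b0 : 0 <= b.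
  by rewrite divr_ge0 ?subr_ge0 ?ler_nat // mulr_ge0 // ltW.
have -> : excess_quad mu m =
    \sum_i #|I|%:R * b * m i ^+ 2 - b * (\sum_i m i) ^+ 2.
  rewrite expr2 big_distrlr mulr_sumr -sumrB; apply: eq_bigr => i _ /=.
  transitivity (\sum_j ((if i == j then #|I|%:R * b else 0) - b) * (m i * m j)).
    apply: eq_bigr => j _; congr (_ * _); rewrite !nice_marginal /b.
    case: eqP => [<-|/eqP ij].
      by rewrite pair_marginalii nice_marginal; field; rewrite ?n0 ?n1' ?t0'.
    by rewrite nice_pair_marginal //; field; rewrite ?n0 ?n1' ?t0'.
  under [LHS]eq_bigr do rewrite mulrBl.
  rewrite sumrB mulr_sumr; congr (_ - _).
  rewrite (bigD1 i) //= eqxx big1 ?addr0 ?expr2 // => j.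
  by rewrite eq_sym => /negPf->; rewrite mul0r.
by rewrite gerBl mulr_ge0 // sqr_ge0.
Qed.
End Nice.

(** * At most one index per block, independently across blocks *)

Section Group.
Context (R : realFieldType) (I : finType) (mu : {set I} -> R) (C : {set {set I}}).
Context (partC : finset.partition C [set: I]%SET).
Context (marginal_neq0 : forall i, marginal mu i != 0).
Context (same_block : forall B i j, B \in C -> i \in B -> j \in B -> i != j ->
  pair_marginal mu i j = 0).
Context (diff_block : forall B B' i j, B \in C -> B' \in C -> B != B' ->
  i \in B -> j \in B' -> pair_marginal mu i j = marginal mu i * marginal mu j).

Lemma mem_block i : finset.pblock C i \in C.
Proof. by rewrite pblock_mem // (finset.cover_partition partC) inE. Qed.

Lemma mem_own_block i : i \in finset.pblock C i.
Proof. by rewrite mem_pblock (finset.cover_partition partC) inE. Qed.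

Lemma sum_blocks (F : I -> R) : \sum_i F i = \sum_(B in C) \sum_(i in B) F i.
Proof.
rewrite -(finset.set_partition_big _ partC).
by apply: eq_bigl => i; rewrite inE.
Qed.

(** A block containing an isolated index is a singleton and contributes exactly
    [m_i ^+ 2]; the other blocks contribute a square on the right only. *)
Lemma sum_isolated_le (m : I -> R) :
  \sum_(i | ([set i] \in C)%SET) m i ^+ 2 <= \sum_(B in C) (\sum_(i in B) m i) ^+ 2.
Proof.
have trivC := finset.partition_trivIset partC.
rewrite big_mkcond sum_blocks.
apply: ler_sum => B BC; rewrite -big_mkcondr.
case: (pickP [pred i | (i \in B) && ([set i] \in C)%SET]) => [i /andP[iB iC]|none].
  have -> : B = [set i]%SET.
    by rewrite -(finset.def_pblock trivC BC iB) -(finset.def_pblock trivC iC (set11 i)).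
  by rewrite big_mkcondr !big_set1 iC.
by rewrite big_pred0 // sqr_ge0.
Qed.

(** The form equals [sum_i m_i^2 / p_i - sum_B (sum_(i in B) m_i)^2]. *)
Lemma group_excess_quad_le (m : I -> R) :
  excess_quad mu m <=
  \sum_i ((marginal mu i)^-1 - ([set i] \in C)%SET%:R) * m i ^+ 2.
Proof.
have trivC := finset.partition_trivIset partC.
have -> : excess_quad mu m =
    \sum_i (marginal mu i)^-1 * m i ^+ 2 - \sum_(B in C) (\sum_(i in B) m i) ^+ 2.
  have -> : \sum_(B in C) (\sum_(i in B) m i) ^+ 2 =
      \sum_i \sum_(j in finset.pblock C i) m i * m j.
    rewrite sum_blocks.
    apply: eq_bigr => B BC; rewrite expr2 big_distrlr /=.
    by apply: eq_bigr => i iB; rewrite (finset.def_pblock trivC BC iB).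
  rewrite -sumrB; apply: eq_bigr => i _.
  rewrite [\sum_(j in _) _]big_mkcond.
  rewrite (bigD1 i) //= [X in _ = _ - X](bigD1 i) //= mem_own_block.
  rewrite pair_marginalii opprD addrA -expr2 -sumrN; congr (_ + _).
    by field.
  apply: eq_bigr => j ji; case: ifP => [jB|/negbT jB].
    rewrite (same_block (mem_block i) (mem_own_block i) jB) 1?eq_sym //.
    by ring.
  rewrite (diff_block (mem_block i) (mem_block j) _ (mem_own_block i) (mem_own_block j)).
    by rewrite divff ?mulf_neq0 //; ring.
  by apply: contraNneq jB => ->; rewrite mem_own_block.
rewrite [leRHS](eq_bigr (fun i => (marginal mu i)^-1 * m i ^+ 2 -
   (if ([set i] \in C)%SET then m i ^+ 2 else 0))); last first.
  by move=> i _; case: (_ \in C) => /=; ring.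
by rewrite sumrB lerB // -big_mkcond sum_isolated_le.
Qed.
End Group.

(** * The law of a sampling *)

Section SamplingLaw.
Context (R : realType) (dT : measure_display) (T : measurableType dT).
Context (P : probability T R) (n : nat) (S : T -> {set 'I_n}).
Context (hS : sampling S).

(** The law of the random set [S], as a real-valued weight on subsets. *)
Definition law (A : {set 'I_n}) : R := fine (P [set w | S w = A]%classic).

Lemma law_ge0 A : 0 <= law A.
Proof. by rewrite fine_ge0. Qed.

Lemma expectation_sampling (g : {set 'I_n} -> R) : (forall A, 0 <= g A) ->
  ('E_P[fun w => g (S w)] = (\sum_A law A * g A)%:E)%E.
Proof.
move=> g0; rewrite unlock.
transitivity (\int[P]_w (\sum_A (g A)%:E * (\1_[set w | S w = A]%classic w)%:E))%E.
  apply: eq_integral => w _.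
  rewrite (bigD1 (S w)) //= big1 ?adde0 => [|A neqA].
    by rewrite indicE mem_set // mule1.
  by rewrite indicE memNset ?mule0 // => /= eqA; rewrite eqA eqxx in neqA.
rewrite ge0_integral_sum //; last 2 first.
- move=> A; apply: measurable_funeM; apply/measurable_EFinP.
  exact: measurable_indic.
- by move=> A w _; rewrite -EFinM lee_fin mulr_ge0 // g0.
rewrite -sumEFin; apply: eq_bigr => A _.
rewrite ge0_integralZl_EFin //; last first.
  by apply/measurable_EFinP; exact: measurable_indic.
rewrite integral_indic // setIT EFinM /law fineK 1?muleC //.
exact: fin_num_measure.
Qed.

Lemma measurable_sampling (Q : pred {set 'I_n}) :
  measurable [set w | Q (S w)]%classic.
Proof.
have -> : [set w | Q (S w)]%classic =
    (\bigcup_(A in [set A | Q A]) [set w | S w = A])%classic.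
  by apply/seteqP; split=> [w Qw | w [A QA /= ->]] //; exists (S w).
by apply: fin_bigcup_measurable => [|A _]; [exact: finite_finset | exact: hS].
Qed.

Lemma prob_sampling (Q : pred {set 'I_n}) :
  P [set w | Q (S w)]%classic = (\sum_(A | Q A) law A)%:E.
Proof.
rewrite -expectation_indic; last exact: measurable_sampling.
transitivity ('E_P[fun w => (Q (S w))%:R])%E.
  congr expectation; apply/funext => w; rewrite indicE; congr (_%:R).
  by congr nat_of_bool; apply/idP/idP => [/set_mem|Qw]; last exact: mem_set.
rewrite (expectation_sampling (g := fun A => (Q A)%:R)); last by move=> A; exact: ler0n.
congr (_%:E); rewrite [RHS]big_mkcond; apply: eq_bigr => A _.
by case: (Q A); rewrite ?mulr1 ?mulr0.
Qed.

Lemma law_total : \sum_A law A = 1.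
Proof.
have := prob_sampling predT.
by have -> : [set w | predT (S w)]%classic = setT; 
  [exact/seteqP|rewrite probability_setT => -[<-]].
Qed.

Lemma incl_prob_marginal i : incl_prob P S i = marginal law i.
Proof.
rewrite /incl_prob (prob_sampling (fun A => i \in A)); apply: eq_bigl => A; by rewrite finset.sub1set.
Qed.

Lemma marginal_le1 i : marginal law i <= 1.
Proof.
rewrite -law_total /marginal /incl_law [leRHS](bigID (fun A : {set 'I_n} => [set i]%SET \subset A)) /=.
by rewrite lerDl sumr_ge0 // => A _; exact: law_ge0.
Qed.


(** A group almost surely contains at most one chosen index: the given
    probabilities of [S :&: B] being empty or a singleton sum to 1. *)
Lemma group_same_block (q : 'I_n -> R) (C : {set {set 'I_n}})
    (hG : group_sampling P q C S) (B : {set 'I_n}) i j :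
  B \in C -> i \in B -> j \in B -> i != j -> pair_marginal law i j = 0.
Proof.
move=> BC iB jB ij.
have q0 k : 0 < q k by have /andP[] := group_weight hG k.
have pick k : k \in B -> \sum_(A | (A :&: B)%SET == [set k]%SET) law A = q k.
  move=> kB; have := group_pick hG BC kB.
  rewrite -[X in P X](_ : [set w | (S w :&: B)%SET == [set k]%SET]%classic = _); last first.
    by apply/seteqP; split=> w /= /eqP.
  rewrite (prob_sampling (fun A => (A :&: B)%SET == [set k]%SET)) => -[->].
  have sB0 : 0 < \sum_(s in B) q s.
    by rewrite (bigD1 i) //= ltr_pwDl // sumr_ge0 // => s _; exact: ltW.
  by rewrite mulrC divfK // lt0r_neq0.
have none : \sum_(A | (A :&: B)%SET == finset.set0) law A = 1 - \sum_(s in B) q s.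
  have := group_none hG BC.
  rewrite -[X in P X](_ : [set w | (S w :&: B)%SET == finset.set0]%classic = _); last first.
    by apply/seteqP; split=> w /= /eqP.
  by rewrite (prob_sampling (fun A => (A :&: B)%SET == finset.set0)) => -[].
apply/eqP; rewrite eq_le andbC sumr_ge0 /= => [|A _]; last exact: law_ge0.
suff : pair_marginal law i j + \sum_(k in B) q k + (1 - \sum_(k in B) q k) <= 1.
  by lra.
(* The three terms are masses of pairwise disjoint families of sets [A], so the
   comparison with the total mass is made for each [A] separately. *)
rewrite -none -[leRHS]law_total (eq_bigr _ (fun k kB => esym (pick k kB))).
rewrite /pair_marginal /incl_law.
rewrite big_mkcond [X in _ + X + _](eq_bigr (fun k =>
  \sum_A if (A :&: B)%SET == [set k]%SET then law A else 0)); last first.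
  by move=> k _; rewrite big_mkcond.
rewrite exchange_big /= [X in _ + _ + X]big_mkcond -!big_split /=.
apply: ler_sum => A _.
have lA := law_ge0 A.
case: ifP => [|_].
  rewrite finset.subUset !finset.sub1set => /andP[iA jA].
  rewrite big1 => [|k _].
    case: eqP => [/setP/(_ i)|_]; first by rewrite !inE iA iB.
    by rewrite !addr0.
  case: eqP => // /setP E; move: (E i) (E j); rewrite !inE iA iB jA jB /=.
  by move=> /esym/eqP ik /esym/eqP jk; rewrite ik jk eqxx in ij.
rewrite add0r; case: eqP => [->|_].
  rewrite big1 ?add0r // => k _; case: eqP => // /setP/(_ k).
  by rewrite !inE eqxx.
rewrite addr0.
case: (pickP [pred k | (k \in B) && ((A :&: B)%SET == [set k]%SET)]) => [k /andP[kB /eqP E]|E].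
  rewrite (bigD1 k) //= E eqxx big1 ?addr0 // => l /andP[_ lk].
  case: eqP => // /setP/(_ l); rewrite !inE eqxx => /eqP kl.
  by rewrite kl eqxx in lk.
by rewrite big1 // => k kB; have := E k; rewrite /= kB /= => ->.
Qed.

Lemma group_diff_block (q : 'I_n -> R) (C : {set {set 'I_n}})
    (hG : group_sampling P q C S) (B B' : {set 'I_n}) i j :
  B \in C -> B' \in C -> B != B' -> i \in B -> j \in B' ->
  pair_marginal law i j = marginal law i * marginal law j.
Proof.
move=> BC B'C BB' iB jB'.
(* Independence of the groups [B] and [B'] is used for the events that [i],
   resp. [j], is chosen there. *)
pose E (D : {set 'I_n}) : {set {set 'I_n}} :=
  if D == B then [set A : {set 'I_n} | i \in A]%SET else [set A : {set 'I_n} | j \in A]%SET.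
have EB (A : {set 'I_n}) : ((A :&: B)%SET \in E B) = (i \in A).
  by rewrite /E eqxx !inE iB andbT.
have EB' (A : {set 'I_n}) : ((A :&: B')%SET \in E B') = (j \in A).
  by rewrite /E eq_sym (negPf BB') !inE jB' andbT.
have sub : ([set B; B'] \subset C)%SET by rewrite finset.subUset !finset.sub1set BC B'C.
have := group_independent hG E sub.
rewrite big_setU1 ?big_set1 ?inE //=.
have -> : [set w | (S w :&: B)%SET \in E B]%classic = [set w | i \in S w]%classic.
  by apply/seteqP; split=> w /=; rewrite EB.
have -> : [set w | (S w :&: B')%SET \in E B']%classic = [set w | j \in S w]%classic.
  by apply/seteqP; split=> w /=; rewrite EB'.
have -> : [set w | forall D, D \in [set B; B']%SET -> (S w :&: D)%SET \in E D]%classic =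
    [set w | [set i; j]%SET \subset S w]%classic.
  apply/seteqP; split=> w /=; rewrite finset.subUset !finset.sub1set.
    by move=> H; rewrite -EB -EB' !H // !inE eqxx ?orbT.
  by move=> /andP[iS jS] D; rewrite !inE => /orP[]/eqP->; rewrite ?EB ?EB'.
rewrite (prob_sampling (fun A => [set i; j]%SET \subset A)) -/(incl_prob P S i) -/(incl_prob P S j) !incl_prob_marginal.
by case.
Qed.

End SamplingLaw.

(** * Admissible constants *)

Section Bounds.
Context (R : realType).

Lemma norm2_sqr d (v : 'cV[R]_d) : norm2 v ^+ 2 = \sum_k v k 0 ^+ 2.
Proof. by rewrite sqr_sqrtr // sumr_ge0 // => k _; exact: sqr_ge0. Qed.

Lemma smooth_sqr d (L : R) (f : 'cV[R]_d -> R) x y : smooth L f ->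
  norm2 (gradient f x - gradient f y) ^+ 2 <= L ^+ 2 * norm2 (x - y) ^+ 2.
Proof.
(* [L] may be negative (when [d = 0]); both sides of the bound are still
   nonnegative, so squaring is monotone. *)
move=> [_ /(_ x y) h]; rewrite -exprMn ler_sqr ?nnegrE ?sqrtr_ge0 //.
by apply: le_trans h; exact: sqrtr_ge0.
Qed.

(** The matrix expression of the definition, in coordinates. *)
Lemma residual_norm2 d n (M : 'M[R]_(d, n)) (p : 'I_n -> R) (A : {set 'I_n}) :
  norm2 (n%:R^-1 *: (M *m weight_mx (fun _ i => 1 / p i) A *m indic_mx A *m ones)
         - n%:R^-1 *: (M *m ones)) ^+ 2 =
  (n%:R ^+ 2)^-1 * \sum_k (\sum_i ((i \in A)%:R / p i - 1) * M k i) ^+ 2.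
Proof.
rewrite norm2_sqr mulr_sumr; apply: eq_bigr => k _.
rewrite -scalerBr mxE exprMn exprVn; congr (_ * _ ^+ 2).
rewrite !mxE -sumrB; apply: eq_bigr => i _.
by rewrite /weight_mx /indic_mx !mul_mx_diag !mxE; ring.
Qed.

Context (dT : measure_display) (T : measurableType dT).
Context (P : probability T R) (d n : nat) (S : T -> {set 'I_n}).
Context (hS : sampling S).
Context (hproper : proper_sampling P S).
Context (f : 'I_n -> 'cV[R]_d -> R).

Let weights := fun (_ : {set 'I_n}) (i : 'I_n) => 1 / incl_prob P S i.

Lemma expectation_residual (M : 'M[R]_(d, n)) :
  ('E_P[fun w => (norm2 (n%:R^-1 *: (M *m weight_mx weights (S w)
                                   *m indic_mx (S w) *m ones)
                  - n%:R^-1 *: (M *m ones)) ^+ 2)%R] =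
  ((n%:R ^+ 2)^-1 * \sum_k excess_quad (law P S) (M k))%:E)%E.
Proof.
have p0 i : marginal (law P S) i != 0.
  by rewrite -incl_prob_marginal // lt0r_neq0.
rewrite (expectation_sampling P hS (g := fun A => norm2 (n%:R^-1 *: (M *m weight_mx weights A
                                   *m indic_mx A *m ones)
                  - n%:R^-1 *: (M *m ones)) ^+ 2)); last by move=> A; exact: sqr_ge0.
congr (_%:E).
under eq_bigr do rewrite residual_norm2 mulrCA mulr_sumr.
rewrite -mulr_sumr exchange_big /=; congr (_ * _); apply: eq_bigr => k _.
rewrite -(second_moment _ (law_total P hS) p0).
by under [RHS]eq_bigr do under eq_bigr do rewrite -incl_prob_marginal //.
Qed.

Context (L : 'I_n -> R).
Context (hf : forall i, smooth (L i) (f i)).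

(** A diagonal bound on the quadratic form gives an admissible constant. *)
Lemma diag_bound_L3_bound (a : 'I_n -> R) : (forall i, 0 <= a i) ->
  (forall m, excess_quad (law P S) m <= \sum_i a i * m i ^+ 2) ->
  L3_bound P f S weights ((n%:R ^+ 2)^-1 * \sum_i a i * L i ^+ 2).
Proof.
move=> a0 ha; have n2 : 0 <= (n%:R ^+ 2)^-1 :> R by rewrite invr_ge0 sqr_ge0.
split.
  by rewrite mulr_ge0 // sumr_ge0 // => i _; rewrite mulr_ge0 // sqr_ge0.
move=> x y; rewrite expectation_residual lee_fin -mulrA ler_wpM2l //.
set M := _ - _.
apply: (@le_trans _ _ (\sum_k \sum_i a i * M k i ^+ 2)).
  by apply: ler_sum => k _; exact: ha.
rewrite exchange_big mulr_suml /=; apply: ler_sum => i _.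
rewrite -mulr_sumr -mulrA ler_wpM2l //.
apply: le_trans (smooth_sqr x y (hf i)).
by rewrite norm2_sqr; rewrite le_eqVlt; apply: predU1l; apply: eq_bigr => k _; rewrite !mxE.
Qed.

(** The infimum of the admissible constants is itself admissible. *)
Lemma is_L3_exists : exists c, is_L3 P f S weights c.
Proof.
have [a [a0 ha]] := excess_quad_diag_bound (law P S).
set B := L3_bound P f S weights.
have B_ex : (B !=set0)%classic.
  by eexists; exact: (diag_bound_L3_bound a0 ha).
have B_lb : has_lbound B by exists 0 => c [].
exists (inf B); split; last exact: ge_inf.
have inf0 : 0 <= inf B by apply: lb_le_inf => // c [].
split=> // x y.
(* If [norm2 (x - y)] vanishes, any admissible constant bounds the expectation
   by 0; otherwise the inequality is divided by [norm2 (x - y) ^+ 2]. *)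
have [N0|N0] := eqVneq (norm2 (x - y) ^+ 2) 0.
  by have [c [_ /(_ x y)]] := B_ex; rewrite N0 !mulr0.
have Npos : 0 < norm2 (x - y) ^+ 2 by rewrite lt_def N0 sqr_ge0.
rewrite expectation_residual lee_fin -ler_pdivrMr //.
apply: lb_le_inf => // c [_ /(_ x y)].
by rewrite expectation_residual lee_fin ler_pdivrMr.
Qed.

End Bounds.

Theorem lemmaH2 (R : realType) (dT : measure_display) (T : measurableType dT)
    (P : probability T R) (d n : nat) (hn : (0 < n)%N)
    (S : T -> {set 'I_n}) (hS : sampling S) (hproper : proper_sampling P S)
    (L : 'I_n -> R) (f : 'I_n -> 'cV[R]_d -> R)
    (hf : forall i, smooth (L i) (f i)) :
  let p := incl_prob P S in
  exists L3 : R,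
    is_L3 P f S (fun _ i => 1 / p i) L3 /\
    (forall tau : nat, (2 <= n)%N -> nice_sampling P tau S ->
       L3 <= (n%:R - tau%:R) / (tau%:R * (n%:R - 1))
             * (n%:R^-1 * \sum_(i < n) L i ^+ 2)) /\
    (forall (q : 'I_n -> R) (C : {set {set 'I_n}}),
       group_sampling P q C S ->
       L3 <= (n%:R ^+ 2)^-1
             * (\sum_(i < n | isolated_index C i) ((p i)^-1 - 1) * L i ^+ 2
                + \sum_(i < n | ~~ isolated_index C i) (p i)^-1 * L i ^+ 2)).
Proof.
move=> p; have [c hc] := is_L3_exists hS hproper hf.
have n0 : n%:R != 0 :> R by rewrite pnatr_eq0 -lt0n.
have p0 i : 0 < marginal (law P S) i by rewrite -incl_prob_marginal.
exists c; split=> //; have [_ c_le] := hc; split.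
- move=> tau n2 [tau_bounds lawS].
  have lawE A : law P S A = if #|A| == tau then ('C(#|'I_n|, tau)%:R)^-1 else 0.
    by rewrite /law lawS card_ord; case: ifP.
  have t_bounds : (1 <= tau <= #|'I_n|)%N by rewrite card_ord.
  have quad_le m : excess_quad (law P S) m <=
      \sum_i (n%:R * ((n%:R - tau%:R) / (tau%:R * (n%:R - 1)))) * m i ^+ 2.
    by have := nice_excess_quad_le t_bounds lawE m; rewrite card_ord; apply.
  have coef_ge0 (i : 'I_n) :
      0 <= n%:R * ((n%:R - tau%:R) / (tau%:R * (n%:R - 1))) :> R.
    have /andP[_ tn] := tau_bounds.
    rewrite mulr_ge0 // divr_ge0 ?subr_ge0 ?ler_nat // mulr_ge0 // subr_ge0.
    by rewrite ler1n ltnW.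
  apply: le_trans (c_le _ (diag_bound_L3_bound hS hproper hf coef_ge0 quad_le)) _.
  rewrite -mulr_sumr; set b := _ / (tau%:R * _); set s := \sum_i _.
  by rewrite le_eqVlt; apply: predU1l; field.
- move=> q C hG.
  have quad_le := group_excess_quad_le (group_partition hG)
    (fun i => lt0r_neq0 (p0 i)) (group_same_block hS hG) (group_diff_block hS hG).
  have coef_ge0 i : 0 <= (marginal (law P S) i)^-1 - ([set i] \in C)%SET%:R.
    rewrite subr_ge0 (@le_trans _ _ 1) ?lern1 ?leq_b1 //.
    by rewrite invf_ge1 // marginal_le1.
  apply: le_trans (c_le _ (diag_bound_L3_bound hS hproper hf coef_ge0 quad_le)) _.
  rewrite ler_wpM2l ?invr_ge0 ?sqr_ge0 // (bigID (isolated_index C)) /=.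
  rewrite le_eqVlt; apply: predU1l; congr (_ + _).
    apply: eq_bigr => i iso; move: iso; rewrite /isolated_index => ->.
    by rewrite /p incl_prob_marginal.
  apply: eq_bigr => i; rewrite /isolated_index => /negPf->.
  by rewrite /p incl_prob_marginal // subr0.
Qed.
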